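(* Let $\epsilon>0$. Let $(\mathbf d_n)_n$ be degree sequences satisfying $Q_n\le 0$, Assumption A (stated in the context) and $\Delta_n\le n^{1/6}$. Let $\theta_0\in(0,1)$ be the smallest solution $\theta$ of $\varphi'(\theta)=0$. Define $$T_n=\frac{1}{\log(\varphi(\theta_0))^{-1}}\cdot\log\left(\frac{(\log(\varphi(\theta_0))^{-1})^{3/2}}{\varphi''(\theta_0)^{1/2}}\,\mathbb E\left[D_ne^{\theta_0D_n}\right]n\right),$$ where $\log(\varphi(\theta_0))^{-1}$ means $\log(1/\varphi(\theta_0))$. If $\theta_0 m\ge\omega(n)T_n$ for some $\omega(n)\to\infty$, then $$\mathbb P\left(L_1(\mathbb{CM}_n(\mathbf d_n))\le(1+\epsilon)T_n\right)=1-o(1)\quad(n\to\infty).$$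
   Context: Asymptotics are as $n\to\infty$. For each $n$, $\mathbf d_n=(d_1,\dots,d_n)$ is a degree sequence on $[n]=\{1,\dots,n\}$ with integers $1\le d_1\le\dots\le d_n$ and $m=\sum_{i\in[n]}d_i$ even; $\Delta_n=d_n$ is the maximum degree. Define $Q_n=\frac1m\sum_{i\in[n]}d_i(d_i-2)$. The configuration model $\mathbb{CM}_n=\mathbb{CM}_n(\mathbf d_n)$ is the random multigraph on $[n]$ obtained by giving $d_i$ half-edges to vertex $i$ and pairing all half-edges uniformly at random. For a (multi)graph $G$ on $[n]$, $L_1(G)$ is the order (number of vertices) of a largest connected component. $D_n$ is the degree of a uniformly random vertex of $[n]$; $\hat D_n$ is its size-biased version, $\mathbb P(\hat D_n=k)=\frac{k\,n\,\mathbb P(D_n=k)}{m}$ for $k\ge1$. Let $\eta=\eta_n=\hat D_n-2$ and $\varphi(\theta)=\varphi_n(\theta)=\mathbb E[e^{\theta\eta_n}]$; thus $\theta_0$ depends on $n$. For integers $b$ and $h\ge1$, $\mathcal L(b,h)=\{b+hk:k\in\mathbb Z\}$. Let $h_n$ be the largest integer $h$ such that $\mathbb P(D_n\in\mathcal L(b,h))=1$ for some $b$. Assumption A: there exists a discrete random variable $D$ supported on $\mathbb Z_{\ge0}$ such that (i) $D_n\to D$ in distribution; (ii) $Q_n\to0$; (iii) $\mathbb P(D\notin\{0,2\})>0$; (iv) if $h$ is the largest integer such that $\mathbb P(D\in\mathcal L(b,h))=1$ for some $b$, then $h_n=h$ for all $n$; (v) $\mathbb E(D_n^4)\le\Delt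a_n^{1/2}$.
   Formalization: The formal theorem adds the assumption that the argument of the outer logarithm in T_n is eventually at least some constant c>1 (otherwise T_n can be negative and the claim is false); conditions imposed for every n are required only for all large n. *)

(* Defs.v *)
From HB Require Import structures.
From mathcomp Require Import all_boot all_order all_algebra.
From mathcomp Require Import all_classical all_reals all_analysis.

Set Implicit Arguments.
Unset Strict Implicit.
Unset Printing Implicit Defensive.

Import Order.TTheory GRing.Theory Num.Theory.
Import numFieldNormedType.Exports.

Local Open Scope classical_set_scope.
Local Open Scope ring_scope.

Definition total_degree n (d : 'I_n -> nat) : nat := (\sum_i d i)%N.

Definition max_degree n (d : 'I_n -> nat) : nat := (\max_i d i)%N.

Definition degree_sequence n (d : 'I_n -> nat) : Prop :=
  [/\ forall i, (1 <= d i)%N,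
      forall i j : 'I_n, (i <= j)%N -> (d i <= d j)%N
    & ~~ odd (total_degree d)].

Definition Qn (R : realType) n (d : 'I_n -> nat) : R :=
  (total_degree d)%:R^-1 * \sum_i (d i)%:R * ((d i)%:R - 2).

Definition half_edge n (d : 'I_n -> nat) : finType := {i : 'I_n & 'I_(d i)}.

(* A perfect matching of the half-edges is a fixed-point-free involution. *)
Definition pairings n (d : 'I_n -> nat) :
    {set {ffun half_edge d -> half_edge d}} :=
  [set f : {ffun half_edge d -> half_edge d} |
    [forall x, (f x != x) && (f (f x) == x)]]%SET.

(* Multigraphs on [n] are given by their adjacency matrix; a loop contributes
   2 to the diagonal entry, one for each of its half-edges. *)
Definition multigraph_of n (d : 'I_n -> nat)
    (f : {ffun half_edge d -> half_edge d}) : 'M[nat]_n :=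
  \matrix_(i, j) #|[pred x | (tag x == i) && (tag (f x) == j)]|.

Definition adjacent n (G : 'M[nat]_n) : rel 'I_n :=
  fun i j => (0 < G i j)%N.

Definition L1 n (G : 'M[nat]_n) : nat :=
  (\max_(i < n) #|connect (adjacent G) i|)%N.

Definition prob_CM (R : realType) n (d : 'I_n -> nat) (E : pred 'M[nat]_n) : R :=
  #|[set f in pairings d | E (multigraph_of f)]%SET|%:R / #|pairings d|%:R.

Definition prob_D (R : realType) n (d : 'I_n -> nat) (A : set nat) : R :=
  #|[pred i : 'I_n | d i \in A]|%:R / n%:R.

Definition expect_D (R : realType) n (d : 'I_n -> nat) (g : nat -> R) : R :=
  (\sum_i g (d i)) / n%:R.

Definition pmf_hatD (R : realType) n (d : 'I_n -> nat) (k : nat) : R :=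
  k%:R * n%:R * prob_D R d [set k] / (total_degree d)%:R.

Definition phi (R : realType) n (d : 'I_n -> nat) (theta : R) : R :=
  \sum_(1 <= k < (max_degree d).+1)
    pmf_hatD R d k * expR (theta * (k%:R - 2)).

Definition lattice (b : int) (h : nat) : set int :=
  [set x | exists k : int, x = b + h%:Z * k].

(* [almost_surely A] says that an integer-valued random variable lies in [A]
   with probability 1. *)
Definition max_span (almost_surely : set nat -> Prop) (h : nat) : Prop :=
  let spans h' := (0 < h')%N /\
    exists b : int, almost_surely [set k | lattice b h' k%:Z] in
  spans h /\ forall h', spans h' -> (h' <= h)%N.

Definition cvg_distribution (R : realType) (d : forall n, 'I_n -> nat)
    (disp : measure_display) (Omega : measurableType disp)
    (P : probability Omega R) (D : {RV P >-> nat}) : Prop :=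
  let F (x : R) : R := fine (P [set w | (D w)%:R <= x]) in
  forall x : R, {for x, continuous F} ->
    prob_D R (d n) [set k | k%:R <= x] @[n --> \oo] --> F x.

Definition assumptionA (R : realType) (d : forall n, 'I_n -> nat) : Prop :=
  exists (disp : measure_display) (Omega : measurableType disp)
         (P : probability Omega R) (D : {RV P >-> nat}),
  [/\ cvg_distribution d D,
      Qn R (d n) @[n --> \oo] --> (0 : R),
      (0 < P [set w | ~ (D w = 0%N \/ D w = 2%N)])%E,
      (forall h : nat, max_span (fun A => P (D @^-1` A) = 1%E) h ->
         \forall n \near \oo, max_span (fun A => prob_D R (d n) A = 1) h)
    & \forall n \near \oo,
        expect_D (d n) (fun k => k%:R ^+ 4)
          <= (max_degree (d n))%:R `^ (2^-1 : R)].

Definition smallest_critical_point (R : realType) n (d : 'I_n -> nat)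
    (theta0 : R) : Prop :=
  [/\ 0 < theta0 < 1, derive1 (phi d) theta0 = 0
    & forall theta : R, 0 < theta < 1 -> derive1 (phi d) theta = 0 ->
        theta0 <= theta].

(* The argument of the outer logarithm in [Tn]. It may be below 1 when [theta0]
   is very small, and [Tn] is then negative: [Tn] only measures a component
   size where this quantity stays above 1. *)
Definition log_arg (R : realType) n (d : 'I_n -> nat) (theta0 : R) : R :=
  ln (1 / phi d theta0) `^ (3 / 2)
    / (derive1n 2 (phi d) theta0) `^ (1 / 2)
  * expect_D d (fun k => k%:R * expR (theta0 * k%:R)) * n%:R.

Definition Tn (R : realType) n (d : 'I_n -> nat) (theta0 : R) : R :=
  1 / ln (1 / phi d theta0) * ln (log_arg d theta0).

(* Main.v *)
(* Explore the component of a vertex [v] half-edge by half-edge: under the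
   tilt [theta0] the number [A] of active half-edges has
   E[exp(theta0 * step)] <= psi := phi(theta0) + s * theta0 / m during the first
   [s] steps, since removing a seen vertex raises the sum defining [phi] by at
   most [theta0], and the smaller number of free half-edges only helps while
   [psi <= 1]. Stopping the supermartingale exp(theta0 * A_k) / psi^k and
   subtracting 1 yields
     P(|C(v)| >= s) * (psi^-(s-1) - 1) <= exp(theta0 * d_v) - 1,
   whose right-hand side carries a factor [theta0 * d_v]. This factor replaces
   the local limit theorem in making the first moment bound sharp enough. Summing
   over [v], dividing by [s] and comparing phi''(theta0) * theta0^2 with
   ln(1/phi(theta0)) gives
   P(L1 > (1 + eps) * Tn) = O(log_arg^(- eps / 2)), and
   [theta0 * m >= omega * Tn] with [log_arg >= c > 1] forces [log_arg] to
   infinity. *)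
Require Import Defs.
From HB Require Import structures.
From mathcomp Require Import all_boot all_order all_algebra.
From mathcomp Require Import perm.
From mathcomp Require Import all_classical all_reals all_analysis.
From mathcomp Require Import ring lra.

Set Implicit Arguments.
Unset Strict Implicit.
Unset Printing Implicit Defensive.

Import Order.TTheory GRing.Theory Num.Theory.
Import numFieldNormedType.Exports.

Local Open Scope classical_set_scope.
Local Open Scope ring_scope.

(** * Exchangeability of the unrevealed half-edges *)

Definition conj_tperm (H : finType) (y z : H) (f : {ffun H -> H}) :
  {ffun H -> H} := [ffun u => tperm y z (f (tperm y z u))].

(** [P] stands for the pairings compatible with what has been revealed, [K] for the revealed
    half-edges. Invariance under swaps outside [K] encodes conditional uniformity without counting
    pairings. *)
Definition exchangeable (H : finType) (P : {set {ffun H -> H}})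
    (K : {set H}) : Prop :=
  forall y z f, y \notin K -> z \notin K -> f \in P -> conj_tperm y z f \in P.

Lemma conj_tpermK (H : finType) (y z : H) : involutive (conj_tperm y z).
Proof. by move=> f; apply/ffunP => u; rewrite !ffunE !tpermK. Qed.

(** The swap of [y] and [z] fixes [x], so conjugation by it sends the first fibre injectively into
    the second. *)
Lemma card_fiber_le (H : finType) (P : {set {ffun H -> H}}) (K : {set H})
    (x y z : H) : exchangeable P K ->
  y \notin K -> z \notin K -> y != x -> z != x ->
  (#|[set f in P | f x == y]%SET| <= #|[set f in P | f x == z]%SET|)%N.
Proof.
move=> exP yK zK yx zx.
rewrite -(card_imset _ (can_inj (conj_tpermK y z))).
apply/subset_leq_card/fintype.subsetP => _ /imsetP[f + ->].
rewrite !inE => /andP[fP /eqP fx].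
by rewrite exP //= ffunE (@tpermD _ y z x) // fx tpermL.
Qed.

Lemma sum_fibers (R : realType) (H : finType) (P : {set {ffun H -> H}})
    (Y : {set H}) (x : H) (G : {ffun H -> H} -> R) :
  (forall f, f \in P -> f x \in Y) ->
  \sum_(f in P) G f = \sum_(y in Y) \sum_(f in [set f in P | f x == y]%SET) G f.
Proof.
move=> hY; rewrite (partition_big (fun f : {ffun H -> H} => f x) (mem Y)) //=.
by apply: eq_bigr => y _; apply: eq_bigl => f; rewrite inE.
Qed.

(** The fibres over admissible partners of [x] partition [P] and have equal size: the partner of [x]
    is uniform on the unrevealed half-edges other than [x]. *)
Lemma card_fiber (R : realType) (H : finType) (P : {set {ffun H -> H}})
    (K : {set H}) (x y : H) : exchangeable P K ->
  (forall f, f \in P -> f x \in (~: K :\ x)%SET) ->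
  y \in (~: K :\ x)%SET ->
  #|[set f in P | f x == y]%SET|%:R = #|P|%:R / #|(~: K :\ x)%SET|%:R :> R.
Proof.
move=> exP hP hy.
have Y0 : #|(~: K :\ x)%SET|%:R != 0 :> R.
  by rewrite pnatr_eq0 -lt0n; apply/card_gt0P; exists y.
apply: (mulIf Y0); rewrite divfK //.
rewrite -[RHS]sumr_const -[in RHS](mul1r 1) (sum_fibers _ hP).
rewrite mulr_natr -sumr_const; apply: eq_bigr => z hz.
move: hy hz; rewrite !inE => /andP[yx yK] /andP[zx zK].
rewrite mul1r sumr_const; congr (_%:R); apply/eqP; rewrite eqn_leq.
by rewrite !(@card_fiber_le _ _ K).
Qed.

(** * Half-edge counts and one step of the exploration *)

Lemma sum_half_edge (R : realType) n (d : 'I_n -> nat) (p : pred 'I_n)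
    (F : 'I_n -> R) :
  \sum_(z : half_edge d | p (tag z)) F (tag z) = \sum_(i | p i) (d i)%:R * F i.
Proof.
have := @sig_big_dep R 0 +%R 'I_n (fun i => 'I_(d i)) p (fun=> xpredT)
          (fun i _ => F i).
rewrite (eq_bigl (fun z : half_edge d => p (tag z))) => [<-|z]; last first.
  by rewrite andbT.
by apply: eq_bigr => i _; rewrite sumr_const card_ord mulr_natl.
Qed.

Lemma card_half_edge_at n (d : 'I_n -> nat) (w : 'I_n) :
  #|[set z : half_edge d | tag z == w]%SET| = d w.
Proof.
rewrite -sum1_card.
transitivity (\sum_(i | i == w) \sum_(k < d i) 1)%N; last first.
  by rewrite big_pred1_eq sum1_card card_ord.
rewrite (@sig_big_dep nat 0%N addn 'I_n (fun i => 'I_(d i)) (pred1 w)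
  (fun=> xpredT) (fun _ _ => 1%N)).
by apply: eq_bigl => z; rewrite inE /= andbT.
Qed.

Lemma card_half_edge n (d : 'I_n -> nat) : #|half_edge d| = total_degree d.
Proof. by rewrite card_tagged sumnE big_map big_enum; apply: eq_bigr => i _; rewrite card_ord. Qed.

Definition active n (d : 'I_n -> nat) (V : {set 'I_n})
    (K : {set half_edge d}) : {set half_edge d} :=
  [set z | (tag z \in V) && (z \notin K)]%SET.

(** Revealing the edge [x y] first activates the half-edges of a new vertex, then removes both [x]
    and [y]; the two successors stand for a subtraction. *)
Lemma card_active_step n (d : 'I_n -> nat) (V : {set 'I_n})
    (K : {set half_edge d}) (x y : half_edge d) :
  (forall z, z \in K -> tag z \in V) ->
  x \in active V K -> y \in (~: K :\ x)%SET ->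
  (#|active (tag y |: V) (x |: (y |: K))|.+2 =
     #|active V K| + (tag y \notin V) * d (tag y))%N.
Proof.
move=> KV; rewrite !inE => /andP[xV xK] /andP[yx yK].
have -> : (#|active V K| + (tag y \notin V) * d (tag y))%N =
   #|active (tag y |: V) K|.
  have [yV|yV] := boolP (tag y \in V).
    by rewrite addn0; apply: eq_card => z; rewrite !inE;
       case: (eqVneq (tag z) (tag y)) => // ->; rewrite yV.
  rewrite mul1n -(card_half_edge_at d (tag y)) -cardsUI.
  rewrite [X in (_ + X)%N](_ : _ = 0%N) ?addn0; last first.
    apply: eq_card0 => z; rewrite !inE.
    by case: (eqVneq (tag z) (tag y)) => [->|]; rewrite ?andbF // (negbTE yV).
  apply: eq_card => z; rewrite !inE.
  case: (eqVneq (tag z) (tag y)) => [e|]; rewrite ?orbF //= orbT.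
  by apply/esym; apply: contra yV => /KV; rewrite e.
have -> : active (tag y |: V) K =
   (x |: (y |: active (tag y |: V) (x |: (y |: K))))%SET.
  apply/setP => z; rewrite !inE.
  case: (eqVneq z x) => [->|zx] /=; first by rewrite xV xK orbT.
  by case: (eqVneq z y) => [->|zy] //=; rewrite eqxx yK.
by rewrite !cardsU1 !inE !eqxx (eq_sym x y) (negbTE yx) /= andbF.
Qed.

Lemma pairingsP n (d : 'I_n -> nat) (f : {ffun half_edge d -> half_edge d}) :
  reflect ((forall x, f x != x) /\ involutive f) (f \in pairings d).
Proof.
rewrite inE; apply: (iffP forallP) => [h|[h1 h2] x].
  by split=> x; have /andP[h1 /eqP h2] := h x.
by rewrite h1 h2 eqxx.
Qed.

Lemma connect_sub_closed n (G : 'M[nat]_n) (V : {set 'I_n}) (v : 'I_n) :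
  (forall i j, i \in V -> Defs.adjacent G i j -> j \in V) -> v \in V ->
  (#|connect (Defs.adjacent G) v| <= #|V|)%N.
Proof.
move=> hV vV; apply/subset_leq_card/fintype.subsetP => w /connectP[p].
elim: p v vV => [|u p IH] v vV /=; first by move=> _ ->.
by case/andP => vu; apply: IH; apply: hV vu.
Qed.

Lemma adjacentP n (d : 'I_n -> nat) (f : {ffun half_edge d -> half_edge d})
    (i j : 'I_n) :
  reflect (exists2 x, tag x = i & tag (f x) = j) (Defs.adjacent (multigraph_of f) i j).
Proof.
rewrite /Defs.adjacent mxE; apply: (iffP card_gt0P) => [[x]|[x <- <-]].
  by rewrite inE => /andP[/eqP ? /eqP ?]; exists x.
by exists x; rewrite inE !eqxx.
Qed.

(* A vertex of degree 1 is the only one whose removal increases the sum. *)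
Lemma drift_unseen (R : realType) n (d : 'I_n -> nat) (theta : R)
    (V : {set 'I_n}) : 0 <= theta ->
  \sum_(i | i \notin V) (d i)%:R * (expR (theta * ((d i)%:R - 2)) - 1) <=
  \sum_i (d i)%:R * (expR (theta * ((d i)%:R - 2)) - 1) + #|V|%:R * theta.
Proof.
move=> th0; rewrite [X in _ <= X + _](bigID (mem V)) /= addrAC lerDr.
rewrite mulr_natl -sumr_const -big_split /=; apply: sumr_ge0 => i _.
case: (d i) => [|[|k]]; first by rewrite mul0r add0r.
  rewrite mul1r; have := expR_ge1Dx (theta * (1 - 2)); lra.
rewrite addr_ge0 // mulr_ge0 // subr_ge0 -[X in X <= _]expR0 ler_expR.
by rewrite mulr_ge0 // subr_ge0 ler_nat.
Qed.

(** Up to the factor [expR (theta * a)], a partner at a seen vertex contributes at most 1 and a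
    partner at an unseen vertex [i] contributes [1 + g i]. The term [s%:R * theta] in the hypothesis
    pays for the seen vertices missing from the sum of [g]. *)
Lemma step_drift (R : realType) n (d : 'I_n -> nat) (theta psi : R) (s : nat)
    (V : {set 'I_n}) (K : {set half_edge d}) (x : half_edge d) :
  0 <= theta -> psi <= 1 -> (#|V| <= s)%N ->
  \sum_i (d i)%:R * expR (theta * ((d i)%:R - 2)) + s%:R * theta <=
    (total_degree d)%:R * psi ->
  (forall z, z \in K -> tag z \in V) -> x \in active V K ->
  \sum_(y in (~: K :\ x)%SET)
    expR (theta * #|active (tag y |: V) (x |: (y |: K))|%:R) <=
  #|(~: K :\ x)%SET|%:R * (psi * expR (theta * #|active V K|%:R)).
Proof.
move=> th0 psi1 Vs hdrift KV xA.
set Y := (~: K :\ x)%SET; set a := #|active V K|%:R.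
pose g (i : 'I_n) : R := expR (theta * ((d i)%:R - 2)) - 1.
have le1 y : y \in Y ->
    expR (theta * #|active (tag y |: V) (x |: (y |: K))|%:R) <=
    expR (theta * a) * (1 + (if tag y \notin V then g (tag y) else 0)).
  move=> yY; have /(congr1 (fun k : nat => k%:R : R)) := card_active_step KV xA yY.
  rewrite -addn2 !natrD natrM -/a => e.
  have -> : #|active (tag y |: V) (x |: (y |: K))|%:R =
    a + ((tag y \notin V)%:R * (d (tag y))%:R - 2) by rewrite addrA -e addrK.
  rewrite mulrDr.
  rewrite expRD ler_pM2l ?expR_gt0 //; case: ifP => _ /=.
    by rewrite mul1r /g addrCA subrr addr0.
  by rewrite mul0r addr0 -[X in _ <= X]expR0 ler_expR; lra.
apply: (le_trans (ler_sum _ le1)); rewrite -mulr_sumr mulrCA mulrC.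
rewrite mulrA ler_pM2r ?expR_gt0 // big_split /= sumr_const -big_mkcondr /=.
rewrite (eq_bigl (fun y : half_edge d => tag y \notin V)); last first.
  move=> y; rewrite !inE; case: (boolP (tag y \in V)) => yV; rewrite ?andbF //=.
  rewrite andbT; apply/andP; split; last by apply: contra yV => /KV.
  by apply: contraNneq yV => ->; move: xA; rewrite inE => /andP[].
rewrite (sum_half_edge d (fun i => i \notin V) g).
have := drift_unseen d V th0; rewrite -/g => h.
have {}h : \sum_(i | i \notin V) (d i)%:R * g i <=
   (total_degree d)%:R * psi - (total_degree d)%:R.
  apply: (le_trans h); rewrite lerBrDr; apply: le_trans hdrift.
  under eq_bigr do rewrite mulrBr mulr1.
  rewrite sumrB -natr_sum -/(total_degree d).
  have : #|V|%:R * theta <= s%:R * theta by rewrite ler_wpM2r // ler_nat.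
  lra.
(* With [m] the total degree, [m * (psi - 1) <= #|Y| * (psi - 1)] since [psi <= 1]: having fewer
   free half-edges only helps. *)
have : #|Y|%:R <= (total_degree d)%:R :> R.
  by rewrite ler_nat -card_half_edge max_card.
move: h; set S := \sum_(i | _) _; nra.
Qed.

(** * Tail of the component size, and first moment over the vertices *)

Definition large_component n (d : 'I_n -> nat) (v : 'I_n) (s : nat)
    (P : {set {ffun half_edge d -> half_edge d}}) :
    {set {ffun half_edge d -> half_edge d}} :=
  [set f in P | (s <= #|connect (Defs.adjacent (multigraph_of f)) v|)%N]%SET.

Lemma card_large_component (R : realType) n (d : 'I_n -> nat) (v : 'I_n)
    (s : nat) (P : {set {ffun half_edge d -> half_edge d}}) :
  #|large_component v s P|%:R = \sum_(f in P)
    (s <= #|connect (Defs.adjacent (multigraph_of f)) v|)%N%:R :> R.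
Proof.
rewrite -sum1_card natr_sum [RHS](bigID (fun f : {ffun half_edge d -> half_edge d} =>
  s <= #|connect (Defs.adjacent (multigraph_of f)) v|)%N) /=.
rewrite [X in _ + X]big1 ?addr0 => [|f /andP[_ /negbTE -> //]].
by apply: eq_big => f; [rewrite inE | rewrite inE => /andP[_ ->]].
Qed.

(* Optional stopping for the supermartingale [expR (theta * active) / psi ^ k],
   where [k] counts the revealed edges; subtracting 1 on both sides gains the
   factor [theta * d v] over the plain Chernoff bound. *)
Lemma explore (R : realType) n (d : 'I_n -> nat) (theta psi : R) (s : nat)
    (v : 'I_n) :
  0 <= theta -> 0 < psi <= 1 ->
  \sum_i (d i)%:R * expR (theta * ((d i)%:R - 2)) + s%:R * theta <=
    (total_degree d)%:R * psi ->
  forall (j : nat) (V : {set 'I_n}) (K : {set half_edge d})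
    (P : {set {ffun half_edge d -> half_edge d}}),
  P \subset pairings d -> exchangeable P K ->
  (forall f x, f \in P -> x \in K -> f x \in K) ->
  (forall x, x \in K -> tag x \in V) -> v \in V -> (#|V| + j <= s)%N ->
  #|large_component v s P|%:R * (psi^-1 ^+ j - 1) <=
  #|P|%:R * (expR (theta * #|active V K|%:R) - 1).
Proof.
(* Induction on the number [j] of edges still to be revealed; each adds at most one vertex to [V],
   so [#|V| + j <= s] persists as [j] drops. *)
move=> th0 /andP[psi0 psi1] hdrift; elim=> [|j IH] V K P Ppair exP fK KV vV Vj.
  rewrite expr0 subrr mulr0 mulr_ge0 // subr_ge0 -[X in X <= _]expR0 ler_expR.
  by rewrite mulr_ge0.
have pP f : f \in P -> f \in pairings d by move/(fintype.subsetP Ppair).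
(* With no active half-edge left, [V] is closed under adjacency and contains the component of [v];
   since [#|V| < s], no pairing of [P] is counted. *)
have [A0|[x xA]] := set_0Vmem (active V K).
  have AK y : tag y \in V -> y \in K.
    by move=> yV; apply: contraPT isT => yK; move/setP/(_ y): A0; rewrite !inE yV yK.
  rewrite [large_component _ _ _](_ : _ = finset.set0); last first.
    apply/setP => f; rewrite !inE; apply/negbTE/negP => /andP[fP].
    apply/negP; rewrite -ltnNge; apply: leq_ltn_trans (_ : #|V| < s)%N; last first.
      by rewrite -addn1 (leq_trans _ Vj) // leq_add2l.
    apply: connect_sub_closed vV => i k iV /adjacentP[y yi <-].
    by apply/KV/fK => //; apply: AK; rewrite yi.
  rewrite cards0 mul0r mulr_ge0 // subr_ge0 -[X in X <= _]expR0 ler_expR.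
  by rewrite mulr_ge0.
set Y := (~: K :\ x)%SET.
have xK : x \notin K by move: xA; rewrite inE => /andP[].
have PY f : f \in P -> f x \in Y.
  move=> fP; have [f1 f2] := pairingsP _ (pP _ fP).
  rewrite !inE f1 /=; apply: contra xK => /(fK _ _ fP).
  by rewrite f2.
pose Q y := [set f in P | f x == y]%SET.
have step y : y \in Y -> #|large_component v s (Q y)|%:R * (psi^-1 ^+ j - 1) <=
   #|Q y|%:R * (expR (theta * #|active (tag y |: V) (x |: (y |: K))|%:R) - 1).
  rewrite !inE => /andP[yx yK].
  apply: IH.
  - by apply: fintype.subset_trans Ppair; apply/fintype.subsetP => f; rewrite inE => /andP[].
  - move=> y1 y2 f; rewrite !inE !negb_or => /and3P[y1x y1y y1K] /and3P[y2x y2y y2K].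
    move=> /andP[fP /eqP fx]; rewrite exP //= ffunE.
    by rewrite (@tpermD _ y1 y2 x) // fx tpermD.
  - move=> f z; rewrite !inE => /andP[fP /eqP fx].
    have [_ f2] := pairingsP _ (pP _ fP).
    case/or3P=> [/eqP ->|/eqP ->|zK]; first by rewrite fx eqxx orbT.
      by rewrite -fx f2 eqxx.
    by rewrite (fK _ _ fP zK) !orbT.
  - move=> z; rewrite !inE => /or3P[/eqP ->|/eqP ->|/KV ->]; rewrite ?eqxx ?orbT //.
    by move: xA; rewrite inE => /andP[->]; rewrite orbT.
  - by rewrite !inE vV orbT.
  - rewrite (leq_trans _ Vj) // addnS -addSn leq_add2r cardsU1.
    by case: (_ \notin _).
have sB : #|large_component v s P|%:R =
    \sum_(y in Y) #|large_component v s (Q y)|%:R :> R.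
  rewrite card_large_component (sum_fibers _ PY); apply: eq_bigr => y _.
  by rewrite card_large_component.
have [P0|Pn0] := eqVneq #|P| 0%N.
  suff -> : #|large_component v s P| = 0%N by rewrite P0 !mul0r.
  apply/eqP; rewrite -leqn0 -P0; apply/subset_leq_card/fintype.subsetP => f.
  by rewrite inE => /andP[].
have Y0 : 0 < #|Y|%:R :> R.
  rewrite ltr0n; move: Pn0; rewrite -lt0n => /card_gt0P[f fP].
  by apply/card_gt0P; exists (f x); apply: PY.
have : \sum_(y in Y) #|large_component v s (Q y)|%:R * (psi^-1 ^+ j - 1) <=
  \sum_(y in Y) #|Q y|%:R *
    (expR (theta * #|active (tag y |: V) (x |: (y |: K))|%:R) - 1).
  exact: ler_sum.
rewrite -mulr_suml -sB.
have -> : \sum_(y in Y) #|Q y|%:R *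
    (expR (theta * #|active (tag y |: V) (x |: (y |: K))|%:R) - 1) =
  #|P|%:R / #|Y|%:R * (\sum_(y in Y)
    expR (theta * #|active (tag y |: V) (x |: (y |: K))|%:R) - #|Y|%:R).
  have {2}-> : #|Y|%:R = \sum_(y in Y) 1 :> R by rewrite sumr_const.
  rewrite -sumrB mulr_sumr; apply: eq_bigr => y yY.
  by rewrite (card_fiber R exP PY yY).
have Vs : (#|V| <= s)%N by rewrite (leq_trans _ Vj) // leq_addr.
have := step_drift th0 psi1 Vs hdrift KV xA; rewrite -/Y.
set S := \sum_(y in Y) _; set a := expR _ => hS h.
have {}h : #|large_component v s P|%:R * (psi^-1 ^+ j - 1) <=
    #|P|%:R * (psi * a - 1).
  apply: (le_trans h); rewrite -mulrA ler_pM2l ?ltr0n ?lt0n //.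
  by rewrite mulrC ler_pdivrMr // mulrBl mul1r [X in _ <= X - _]mulrC lerB.
have hB : #|large_component v s P|%:R <= #|P|%:R :> R.
  rewrite ler_nat; apply/subset_leq_card/fintype.subsetP => f.
  by rewrite inE => /andP[].
(* After multiplication by [psi], the claim is the sum of [h] and of
   [b * (1 - psi) <= #|P| * (1 - psi)], which follows from [hB]. *)
rewrite -(ler_pM2l psi0) exprS.
have -> : psi * (#|large_component v s P|%:R * (psi^-1 * psi^-1 ^+ j - 1)) =
    #|large_component v s P|%:R * (psi^-1 ^+ j - psi).
  by rewrite mulrCA mulrBr mulVKf ?gt_eqF // mulr1.
move: h hB; set b := #|large_component v s P|%:R; set q := psi^-1 ^+ j.
nra.
Qed.

(** A pairing with [s <= L1] has at least [s] vertices in components of order at least [s], so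
    Markov's inequality gains the factor [s] over a union bound. The exponent is [s.-1] because the
    starting vertex is already seen. *)
Lemma prob_large_L1 (R : realType) n (d : 'I_n -> nat) (theta psi : R) (s : nat) :
  0 <= theta -> 0 < psi <= 1 ->
  \sum_i (d i)%:R * expR (theta * ((d i)%:R - 2)) + s%:R * theta <=
    (total_degree d)%:R * psi -> (0 < s)%N ->
  prob_CM R d (fun G => (s <= L1 G)%N) * (s%:R * (psi^-1 ^+ s.-1 - 1)) <=
  \sum_v (expR (theta * (d v)%:R) - 1).
Proof.
move=> th0 hpsi hdrift s0; have [psi0 psi1] := andP hpsi.
have bound v : #|large_component v s (pairings d)|%:R * (psi^-1 ^+ s.-1 - 1) <=
   #|pairings d|%:R * (expR (theta * (d v)%:R) - 1).
  have := @explore R n d theta psi s v th0 hpsi hdrift s.-1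
    [set v]%SET finset.set0 (pairings d).
  have -> : #|active [set v]%SET (@finset.set0 (half_edge d))| = d v.
    rewrite -(card_half_edge_at d v); apply: eq_card => z.
    by rewrite !inE andbT.
  apply => //.
  - move=> y z f _ _ /pairingsP[f1 f2]; apply/pairingsP; split => x.
      rewrite ffunE; apply: contraNN (f1 (tperm y z x)) => /eqP e.
      by rewrite -{2}e tpermK.
    by rewrite !ffunE tpermK f2 tpermK.
  - by move=> f x _; rewrite inE.
  - by move=> x; rewrite inE.
  - by rewrite inE.
  - by rewrite cards1 add1n prednK.
have hL : #|[set f in pairings d | (s <= L1 (multigraph_of f))%N]%SET|%:R * s%:R
    <= \sum_v #|large_component v s (pairings d)|%:R :> R.
  under [X in _ <= X]eq_bigr do rewrite card_large_component.
  rewrite exchange_big /= mulr_natl -sumr_const.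
  rewrite [X in _ <= X](bigID (fun f : {ffun half_edge d -> half_edge d} =>
    s <= L1 (multigraph_of f))%N) /=.
  rewrite ler_wpDr //; first by apply: sumr_ge0 => f _; apply: sumr_ge0.
  rewrite big_mkcond [X in _ <= X]big_mkcond; apply: ler_sum => f _.
  rewrite inE; case: ifP => // /andP[fP hs].
  have [v0 hv0] : exists v0, (s <= #|connect (Defs.adjacent (multigraph_of f)) v0|)%N.
    apply/existsP; apply: contraTT hs; rewrite negb_exists => /forallP hs.
    rewrite -ltnNge /L1; rewrite -(prednK s0) ltnS; apply/bigmax_leqP => i _.
    by have := hs i; rewrite -ltnNge -{1}(prednK s0) ltnS.
  have [_ f2] := pairingsP _ fP.
  have sym : symmetric (Defs.adjacent (multigraph_of f)).
    suff sub i k : Defs.adjacent (multigraph_of f) i k ->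
        Defs.adjacent (multigraph_of f) k i.
      by move=> i k; apply/idP/idP; apply: sub.
    by case/adjacentP => x <- <-; apply/adjacentP; exists (f x); rewrite ?f2.
  apply: (@le_trans _ _ #|connect (Defs.adjacent (multigraph_of f)) v0|%:R).
    by rewrite ler_nat.
  rewrite -sum1_card natr_sum big_mkcond; apply: ler_sum => w _.
  case: ifP => // hw.
  rewrite (eq_card (_ : _ =i connect (Defs.adjacent (multigraph_of f)) v0)) ?hv0 //.
  by move=> z; rewrite -!topredE /= -(same_connect (sym_connect_sym sym) hw).
(* Without pairings [prob_CM] is 0, by the convention [0^-1 = 0]. *)
rewrite /prob_CM; have [P0|Pn0] := eqVneq #|pairings d| 0%N.
  rewrite P0 invr0 mulr0 mul0r; apply: sumr_ge0 => v _.
  by rewrite subr_ge0 -[X in X <= _]expR0 ler_expR mulr_ge0.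
have P0 : 0 < #|pairings d|%:R :> R by rewrite ltr0n lt0n.
rewrite mulrAC ler_pdivrMr // mulrA.
apply: (@le_trans _ _ (\sum_v #|large_component v s (pairings d)|%:R *
   (psi^-1 ^+ s.-1 - 1))).
  rewrite -mulr_suml ler_wpM2r // subr_ge0.
  by rewrite exprn_ege1 // invf_ge1.
by rewrite mulrC mulr_sumr; apply: ler_sum => v _.
Qed.

(** Ranks [2k] and [2k + 1] are swapped; evenness keeps [2k + 1] in range. Pairings therefore exist
    when the total degree is even, and [prob_CM] is a genuine probability. *)
Lemma even_card_involution (H : finType) : ~~ odd #|H| ->
  exists f : {ffun H -> H}, (forall x, f x != x) /\ involutive f.
Proof.
move=> evH; pose sw k := if odd k then k.-1 else k.+1.
have swlt (k : 'I_#|H|) : (sw k < #|H|)%N.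
  rewrite /sw; case: ifP => ok; first by rewrite (leq_ltn_trans (leq_pred _)).
  rewrite ltn_neqAle ltn_ord andbT.
  by apply: contraNneq evH => <-; rewrite /= ok.
pose f := [ffun x : H => enum_val (Ordinal (swlt (enum_rank x)))].
have sw_neq k : sw k != k.
  by rewrite /sw; case: k => //= k; case: ifP => _; rewrite ?(gtn_eqF (ltnSn _)) // ltn_eqF.
have swK : involutive sw.
  by move=> [|k]; rewrite /sw //=; case: (boolP (odd k)) => ok; rewrite /= ?ok ?(negbTE ok).
exists f; split=> x.
  apply: contraNneq (sw_neq (enum_rank x)) => /(congr1 enum_rank).
  by rewrite ffunE enum_valK => /(congr1 (@nat_of_ord _)) /= ->.
apply: enum_rank_inj; rewrite !ffunE !enum_valK; apply: val_inj => /=.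
exact: swK.
Qed.

Lemma pairings_gt0 n (d : 'I_n -> nat) : ~~ odd (total_degree d) ->
  (0 < #|pairings d|)%N.
Proof.
rewrite -card_half_edge => /even_card_involution[f hf].
by apply/card_gt0P; exists f; apply/pairingsP.
Qed.

(** * Derivatives of [phi] as sums over vertices *)

(** This is the [p]-th derivative of [phi], that is, the expectation of [eta^p e^(theta eta)] with
    [eta] the size-biased degree minus 2. *)
Definition tilted (R : realType) n (d : 'I_n -> nat) (p : nat) (theta : R) : R :=
  (total_degree d)%:R^-1 *
  \sum_i (d i)%:R * ((d i)%:R - 2) ^+ p * expR (theta * ((d i)%:R - 2)).

Lemma phiE (R : realType) n (d : 'I_n -> nat) : phi d = tilted d 0 :> (R -> R).
Proof.
apply/funext => theta; rewrite /phi /tilted mulr_sumr.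
transitivity (\sum_(1 <= k < (max_degree d).+1) \sum_i
  (if k == d i then (total_degree d)%:R^-1 * (k%:R * expR (theta * (k%:R - 2)))
   else 0) : R).
  apply: eq_bigr => k _; rewrite /pmf_hatD /prob_D.
  have -> : k%:R * n%:R * (#|[pred i | d i \in [set k]]|%:R / n%:R)
      / (total_degree d)%:R * expR (theta * (k%:R - 2)) =
      #|[pred i | k == d i]|%:R *
       ((total_degree d)%:R^-1 * (k%:R * expR (theta * (k%:R - 2)))) :> R.
    have -> : #|[pred i | d i \in [set k]]| = #|[pred i | k == d i]|.
      by apply: eq_card => i; rewrite !inE eq_sym; apply/idP/eqP; rewrite inE.
    have [n0|n0] := eqVneq (n%:R : R) 0.
      rewrite n0 mulr0 !mul0r; move/eqP: n0; rewrite pnatr_eq0 => /eqP n0.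
      by rewrite eq_card0 ?mul0r // => i; have := ltn_ord i; rewrite [X in (_ < X)%N]n0.
    by set mi := (total_degree d)%:R^-1; set e := expR _; field.
  by rewrite -big_mkcond sumr_const mulr_natl.
rewrite exchange_big; apply: eq_bigr => i _ /=.
have [->|di] := eqVneq (d i) 0%N.
  rewrite !mul0r mulr0 big_nat_cond big1 // => k; case: eqVneq => // ->.
  by rewrite ltnn.
rewrite -big_mkcond big_nat1_eq lt0n di ltnS /max_degree leq_bigmax /=.
by rewrite expr0 mulr1.
Qed.

Lemma is_derive_tilted (R : realType) n (d : 'I_n -> nat) p (x : R) :
  is_derive x 1 (tilted d p) (tilted d p.+1 x).
Proof.
rewrite /tilted.
pose h i : R -> R := fun t => (d i)%:R * ((d i)%:R - 2) ^+ p *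
   expR (t * ((d i)%:R - 2)).
have -> : (fun theta : R => (total_degree d)%:R^-1 *
  \sum_i (d i)%:R * ((d i)%:R - 2) ^+ p * expR (theta * ((d i)%:R - 2))) =
  (total_degree d)%:R^-1 *: (\sum_i h i).
  by apply/funext => t; rewrite fctE fct_sumE.
apply: is_deriveZ; apply: is_derive_sum => i.
rewrite /h; apply: is_derive_eq.
by rewrite /GRing.scale /= !mulr1 ?mulr0 ?addr0 exprSr; ring.
Qed.

Lemma derive_phi (R : realType) n (d : 'I_n -> nat) :
  derive1 (phi d) = tilted d 1 :> (R -> R).
Proof.
apply/funext => x; rewrite phiE derive1E.
by have := is_derive_tilted d 0 x => h; rewrite derive_val.
Qed.

Lemma derive2_phi (R : realType) n (d : 'I_n -> nat) :
  derive1n 2 (phi d) = tilted d 2 :> (R -> R).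
Proof.
apply/funext => x; rewrite derive1nS /= derive_phi derive1E.
by have := is_derive_tilted d 1 x => h; rewrite derive_val.
Qed.

(** * Quadratic bounds for the exponential *)

(** Square [1 - x / 2 <= expR (- (x / 2))], whose left side is nonnegative for [x <= 2]. *)
Lemma expRN_quadratic_le2 (R : realType) (x : R) : x <= 2 ->
  x ^+ 2 / 4 <= expR (- x) - 1 + x.
Proof.
move=> x2; have : (1 - x / 2) ^+ 2 <= expR (- x).
  have -> : - x = 2%:R * (- (x / 2)) by lra.
  rewrite expRM_natl; apply: lerXn2r; rewrite ?nnegrE ?expR_ge0 //; first lra.
  by have := expR_ge1Dx (- (x / 2)).
nra.
Qed.

(** Beyond 2 the last bracket may grow only linearly, so one factor [x] is absorbed by [X]:
    [x ^+ 2 <= X * (2 * (x - 1))]. *)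
Lemma expRN_quadratic (R : realType) (x X : R) : x <= X -> 0 <= X ->
  x ^+ 2 <= 4 * (1 + X) * (expR (- x) - 1 + x).
Proof.
move=> xX X0; have [/expRN_quadratic_le2 h|x2] := leP x 2.
  have := sqr_ge0 x; nra.
have := expR_gt0 (- x); nra.
Qed.

(** The right-hand side is [expR x * (expR (- x) - 1 + x)]. Up to 2, the quadratic bound and
    [expR (-1) <= expR x] suffice; beyond 2, it is at least [(1 + x) * (x - 1)]. *)
Lemma expR_quadratic_lb (R : realType) (x : R) : -1 <= x ->
  expR (-1) / 4 * x ^+ 2 <= 1 - expR x + x * expR x.
Proof.
move=> x1; have e1 : expR (-1) <= 1 :> R by rewrite -[leRHS]expR0 ler_expR; lra.
have e0 : 0 < expR (-1) :> R := expR_gt0 _.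
have -> : 1 - expR x + x * expR x = expR x * (expR (- x) - 1 + x).
  by rewrite !mulrDr mulrN1 expRN mulfV ?gt_eqF ?expR_gt0 // (mulrC x).
have [/expRN_quadratic_le2 h|x2] := leP x 2.
  have ex : expR (-1) <= expR x by rewrite ler_expR.
  rewrite mulrAC -mulrA.
  by apply: ler_pM => //; rewrite ?expR_ge0 ?divr_ge0 ?sqr_ge0.
have h1 := expR_ge1Dx x; have := expR_gt0 (- x); set u := expR (- x) => u0.
apply: (@le_trans _ _ ((1 + x) * (x - 1))); first nra.
by apply: ler_pM => //; lra.
Qed.

(** * Bounds on the total degree *)

Lemma total_degree_ge n (d : 'I_n -> nat) : (forall i, (1 <= d i)%N) ->
  (n <= total_degree d)%N.
Proof.
move=> d1; rewrite -{1}(card_ord n) -sum1_card; exact: leq_sum.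
Qed.

(** The sum of [d * (d - 2)] is at most 0, and [d - 2 <= d * (d - 2)] for every integer [d >= 1]. *)
Lemma total_degree_le (R : realType) n (d : 'I_n -> nat) :
  (forall i, (1 <= d i)%N) -> Qn R d <= 0 ->
  (total_degree d)%:R <= 2 * n%:R :> R.
Proof.
move=> d1; have [n0|n0] := posnP n.
  by move: d d1; rewrite n0 => d d1 _; rewrite /total_degree big_ord0 mulr0.
have m0 : 0 < (total_degree d)%:R :> R.
  by rewrite ltr0n (leq_trans n0) // total_degree_ge.
rewrite /Qn pmulr_rle0 ?invr_gt0 // => h.
have : \sum_i ((d i)%:R - 2 : R) <= 0.
  apply: le_trans h; apply: ler_sum => i _; have := d1 i.
  case: (d i) => [//|[|k]] _; first by lra.
  have : 0 <= k%:R :> R by []. rewrite -!natr1; nra.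
rewrite sumrB -natr_sum sumr_const card_ord -/(total_degree d) -mulr_natl; lra.
Qed.

Lemma degree_le_max (R : realType) n (d : 'I_n -> nat) i :
  (d i)%:R <= (max_degree d)%:R :> R.
Proof. by rewrite ler_nat /max_degree leq_bigmax. Qed.

Lemma tilted0_ge (R : realType) n (d : 'I_n -> nat) (theta : R) :
  (forall i, (1 <= d i)%N) -> (0 < n)%N -> 0 <= theta ->
  expR (- theta) <= tilted d 0 theta.
Proof.
move=> d1 n0 th0; have m0 : 0 < (total_degree d)%:R :> R.
  by rewrite ltr0n (leq_trans n0) // total_degree_ge.
rewrite /tilted mulrC ler_pdivlMr // natr_sum mulr_sumr; apply: ler_sum => i _.
rewrite expr0 mulr1 mulrC ler_wpM2l // ler_expR.
have : 1 <= (d i)%:R :> R by rewrite ler1n.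
nra.
Qed.

(** * Estimates at a critical point of [phi] *)

Section CriticalPoint.
Variables (R : realType) (n : nat) (d : 'I_n -> nat) (theta : R).
Hypotheses (d1 : forall i, (1 <= d i)%N) (n0 : (0 < n)%N) (th0 : 0 < theta)
  (th1 : theta < 1) (crit : tilted d 1 theta = 0).

Let m0 : 0 < (total_degree d)%:R :> R.
Proof. by rewrite ltr0n (leq_trans n0) // total_degree_ge. Qed.

Let x i : R := theta * ((d i)%:R - 2).

Let x_ge i : -1 <= x i.
Proof.
rewrite /x; have d1R : 0 <= (d i)%:R - 1 :> R by rewrite subr_ge0 ler1n.
have := mulr_ge0 (ltW th0) d1R; move: th1; rewrite !mulrBr; lra.
Qed.

(** Adding [theta * phi'(theta) = 0] turns the summands [1 - expR (x i)], of no fixed sign, into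
    nonnegative ones of quadratic order near 0. *)
Lemma critical_defect : 1 - tilted d 0 theta =
  (total_degree d)%:R^-1 *
    \sum_i (d i)%:R * (1 - expR (x i) + x i * expR (x i)).
Proof.
transitivity (1 - tilted d 0 theta + theta * tilted d 1 theta).
  by rewrite crit mulr0 addr0.
rewrite /tilted.
rewrite -[X in X - _ + _](mulVf (lt0r_neq0 m0)) natr_sum mulrCA -mulrBr -mulrDr.
congr (_ * _); rewrite mulr_sumr -sumrB -big_split /=; apply: eq_bigr => i _.
by rewrite expr0 expr1 -/(x i) /x; ring.
Qed.

(** Termwise comparison with [critical_defect] once [expR (x i)] is factored out; [theta * Delta]
    bounds every [x i]. *)
Lemma critical_variance_le :
  theta ^+ 2 * tilted d 2 theta <=
  4 * (1 + theta * (max_degree d)%:R) * (1 - tilted d 0 theta).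
Proof.
rewrite critical_defect /tilted !(mulrCA _ _^-1) ler_pM2l ?invr_gt0 //.
rewrite !mulr_sumr; apply: ler_sum => i _.
have -> : theta ^+ 2 * ((d i)%:R * ((d i)%:R - 2) ^+ 2 *
    expR (theta * ((d i)%:R - 2))) = (d i)%:R * (x i ^+ 2 * expR (x i)).
  by rewrite /x; ring.
rewrite [leRHS]mulrCA ler_wpM2l //.
have -> : 1 - expR (x i) + x i * expR (x i) =
    (expR (- x i) - 1 + x i) * expR (x i).
  by rewrite !mulrDl mulN1r expRN mulVf ?gt_eqF ?expR_gt0.
rewrite mulrA ler_pM2r ?expR_gt0 //; apply: expRN_quadratic.
  by rewrite /x ler_wpM2l ?ltW //; have := degree_le_max R d i; lra.
by rewrite mulr_ge0 // ltW.
Qed.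

(** A vertex of degree other than 2 has [(d i - 2) ^+ 2 >= 1], and [theta < 1] gives [x i >= -1], so
    its term is at least [expR (-1) / 4 * theta ^+ 2]. *)
Lemma critical_defect_ge :
  expR (-1) / 4 * theta ^+ 2 *
    (#|[pred i | d i != 2%N]|%:R / (total_degree d)%:R) <= 1 - tilted d 0 theta.
Proof.
rewrite critical_defect mulrA mulrC ler_pM2l ?invr_gt0 // mulr_natr -sumr_const.
rewrite big_mkcond; apply: ler_sum => i _.
have e0 : 0 < expR (-1) :> R := expR_gt0 _.
have h := expR_quadratic_lb (x_ge i).
case: ifP => [|_]; last first.
  by rewrite mulr_ge0 //; apply: le_trans h; rewrite mulr_ge0 ?sqr_ge0 ?divr_ge0 ?ltW.
rewrite inE => di; have d1R : 1 <= (d i)%:R :> R by rewrite ler1n.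
have sq : 1 <= ((d i)%:R - 2) ^+ 2 :> R.
  have := d1 i; move: di; case: (d i) => [//|[|[//|k]]] _ _; first by lra.
  have : 0 <= k%:R :> R by []. rewrite -!natr1; nra.
apply: (@le_trans _ _ (expR (-1) / 4 * x i ^+ 2)).
  apply: ler_wpM2l; first by rewrite divr_ge0 ?ltW.
  by rewrite /x exprMn ler_peMr ?sqr_ge0.
apply: (le_trans h); rewrite ler_peMl //; apply: le_trans h.
by rewrite mulr_ge0 ?sqr_ge0 ?divr_ge0 ?ltW.
Qed.

(** Subtracting [Delta * phi'(theta) = 0] produces the factor [(d - 2) * (d - 2 - Delta)],
    nonpositive for [d >= 2] and equal to [1 + Delta <= 2 * Delta] for [d = 1]. *)
Lemma critical_variance_le_max : tilted d 2 theta <= 2 * (max_degree d)%:R.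
Proof.
have -> : tilted d 2 theta =
    tilted d 2 theta - (max_degree d)%:R * tilted d 1 theta.
  by rewrite crit mulr0 subr0.
rewrite /tilted.
rewrite mulrCA -mulrBr mulrC ler_pdivrMr // natr_sum !mulr_sumr -sumrB.
apply: ler_sum => i _; have D := degree_le_max R d i.
have d1R : 1 <= (d i)%:R :> R by rewrite ler1n.
rewrite -/(x i) expr1.
have -> : (d i)%:R * ((d i)%:R - 2) ^+ 2 * expR (x i) -
    (max_degree d)%:R * ((d i)%:R * ((d i)%:R - 2) * expR (x i)) =
    (((d i)%:R - 2) * ((d i)%:R - 2 - (max_degree d)%:R)) * expR (x i) * (d i)%:R.
  by ring.
rewrite ler_wpM2r //.
have := d1 i; case E : (d i) => [//|[|k]] _; rewrite /x E; last first.
  apply: (@le_trans _ _ 0); last by rewrite mulr_ge0.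
  rewrite pmulr_lle0 ?expR_gt0 //; move: D; rewrite E -!natr1.
  have : 0 <= k%:R :> R by []. nra.
have e1 : expR (theta * (1 - 2)) <= 1.
  by rewrite -[leRHS]expR0 ler_expR; move: th0; lra.
have := expR_gt0 (theta * (1 - 2)); move: D; rewrite E; nra.
Qed.

(** In the vanishing sum behind [phi'(theta)] only degree 1 gives negative terms, each at least -1.
    With 1 added to every term the sum is [n], and it dominates the term of a vertex of maximal
    degree. *)
Lemma critical_expR_max_le : 2 < (max_degree d)%:R :> R ->
  expR (theta * ((max_degree d)%:R - 2)) <= (total_degree d)%:R.
Proof.
move=> D2; have [i0 hi0] : {i0 | max_degree d = d i0}.
  have [|i ?] := @bigop.eq_bigmax _ d; first by rewrite card_ord.
  by exists i.
pose h i : R := (d i)%:R * ((d i)%:R - 2) * expR (x i) + 1.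
have h0 i : 0 <= h i.
  rewrite /h /x; have := d1 i; case: (d i) => [//|[|k]] _.
    have : expR (theta * (1 - 2)) <= 1.
      by rewrite -[leRHS]expR0 ler_expR; move: th0; lra.
    lra.
  by rewrite addr_ge0 // mulr_ge0 ?expR_ge0 // mulr_ge0 //.
have hn : \sum_i h i = n%:R.
  rewrite big_split /= sumr_const card_ord [X in X + _](_ : _ = 0) ?add0r //.
  move/eqP: crit; rewrite /tilted mulf_eq0 invr_eq0 gt_eqF //= => /eqP.
  by under eq_bigr do rewrite expr1.
have : h i0 <= (total_degree d)%:R.
  apply: (@le_trans _ _ n%:R); last by rewrite ler_nat total_degree_ge.
  by rewrite -hn (bigD1 i0) //= lerDl sumr_ge0.
rewrite /h /x -hi0; move: D2; rewrite ltr_nat => D3.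
have D3R : 3 <= (max_degree d)%:R :> R by rewrite ler_nat.
apply: le_trans; apply: (@le_trans _ _ (expR (theta * ((max_degree d)%:R - 2)) + 1)).
  by rewrite lerDl.
rewrite lerD2r ler_peMl ?expR_ge0 //; move: D3R; nra.
Qed.

End CriticalPoint.

(** * The probability bound for a fixed [n], in terms of [log_arg] *)

Lemma prob_CM_compl (R : realType) n (d : 'I_n -> nat) (E : pred 'M[nat]_n) :
  (0 < #|pairings d|)%N ->
  prob_CM R d E = 1 - prob_CM R d (fun G => ~~ E G).
Proof.
move=> P0; rewrite /prob_CM; apply/eqP; rewrite eq_sym subr_eq -mulrDl.
rewrite -natrD -cardsUI [X in (_ + X)%N](_ : _ = 0%N); last first.
  by apply: eq_card0 => f; rewrite !inE; case: (E _); rewrite ?andbF.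
rewrite addn0 [X in X%:R](_ : _ = #|pairings d|); last first.
  by apply: eq_card => f; rewrite !inE -andb_orr orbN andbT.
by rewrite divff // pnatr_eq0 -lt0n.
Qed.

Definition exp_moment (R : realType) n (d : 'I_n -> nat) (theta : R) : R :=
  \sum_i (d i)%:R * expR (theta * (d i)%:R).

Lemma total_degree_le_exp_moment (R : realType) n (d : 'I_n -> nat) (theta : R) :
  0 <= theta -> (total_degree d)%:R <= exp_moment d theta.
Proof.
move=> th0; rewrite natr_sum; apply: ler_sum => i _; rewrite ler_peMr //.
by rewrite -[X in X <= _]expR0 ler_expR mulr_ge0.
Qed.

(** From [1 - x <= expR (- x)] follows [expR x - 1 <= x * expR x], which keeps the factor
    [theta]. *)
Lemma sum_expRB1_le (R : realType) n (d : 'I_n -> nat) (theta : R) :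
  \sum_i (expR (theta * (d i)%:R) - 1) <= theta * exp_moment d theta.
Proof.
rewrite /exp_moment mulr_sumr; apply: ler_sum => i _; rewrite mulrA.
set x := theta * _; have := expR_ge1Dx (- x).
have := expRxMexpNx_1 x; have := expR_gt0 x.
by set e := expR x; set e' := expR (- x); nra.
Qed.

Lemma ln_log_arg (R : realType) n (d : 'I_n -> nat) (theta : R) :
  (0 < n)%N -> 0 < ln (1 / phi d theta) -> 0 < derive1n 2 (phi d) theta ->
  0 < exp_moment d theta ->
  ln (log_arg d theta) = 3 / 2 * ln (ln (1 / phi d theta))
    - 1 / 2 * ln (derive1n 2 (phi d) theta) + ln (exp_moment d theta).
Proof.
move=> n0 l0 v0 B0; rewrite /log_arg /expect_D -/(exp_moment d theta).
rewrite -mulrA divfK ?pnatr_eq0 -?lt0n //.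
move: l0; set l := ln (1 / _) => l0.
by rewrite lnM ?ln_div ?ln_powR ?posrE ?divr_gt0 ?powR_gt0.
Qed.

(* Here [l = ln (1 / phi theta)], [v = phi'' theta] and [B] is [exp_moment], so
   that the last bracket is [ln (log_arg d theta)]. If [theta * Delta > 2] then
   [theta] is at least of order [N ^ (-1/6)], which makes [log_arg] at least a
   positive power of [N], while [theta * Delta = O(ln N)]. *)
Lemma exponent_le_ln (R : realType) (kappa theta l v Delta N B m : R) :
  0 < kappa -> 0 < theta < 1 -> kappa * theta ^+ 2 <= l ->
  0 < v <= 2 * Delta -> 1 <= N <= B -> m <= 2 * N ->
  Delta <= N `^ 6^-1 -> (2 < Delta -> expR (theta * (Delta - 2)) <= m) ->
  0 <= 3 / 2 * ln l - 1 / 2 * ln v + ln B ->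
  1 + theta * Delta <=
    9 + 4 * `|ln kappa| + 3 * (3 / 2 * ln l - 1 / 2 * ln v + ln B).
Proof.
move=> k0 /andP[th0 th1] kl /andP[v0 vD] /andP[N1 NB] mN DN hD y0.
have abs0 : 0 <= `|ln kappa| by [].
have [le2|gt2] := leP (theta * Delta) 2; first lra.
have D2 : 2 < Delta by nra.
have N0 : 0 < N by lra.
have hlm : theta * (Delta - 2) <= ln 2 + ln N.
  rewrite -lnM ?posrE // -[X in X <= _]expRK ler_ln ?posrE ?expR_gt0 ?mulr_gt0 //.
  exact: le_trans (hD D2) mN.
have ln2 : ln (2 : R) <= 1 by have := @le_ln1Dx R 1; rewrite (_ : 1 + 1 = 2) //; apply; lra.
have ln2' : 0 <= ln (2 : R) by rewrite ln_ge0 //; lra.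
have hk : ln kappa + 2 * ln theta <= ln l.
  have -> : 2 * ln theta = ln (theta ^+ 2) by rewrite lnXn // mulr_natl.
  rewrite -lnM ?posrE ?exprn_gt0 // ler_ln ?posrE //.
    by rewrite mulr_gt0 ?exprn_gt0.
  by apply: lt_le_trans kl; rewrite mulr_gt0 ?exprn_gt0.
have hth : ln 2 <= ln theta + ln Delta.
  rewrite -lnM ?posrE ?ler_ln ?posrE ?mulr_gt0 //; lra.
have hv : ln v <= ln 2 + ln Delta.
  rewrite -lnM ?posrE ?ler_ln ?posrE ?mulr_gt0 //; lra.
have hDN : ln Delta <= 6^-1 * ln N.
  rewrite -ln_powR ler_ln ?posrE ?powR_gt0 //; lra.
have hB : ln N <= ln B by rewrite ler_ln ?posrE //; lra.
have habs : - `|ln kappa| <= ln kappa by rewrite lerNl -normrN ler_norm.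
(* With [y] for the bracket, these give [y >= 5/12 * ln N - 3/2 * |ln kappa|], where
   [5/12 = 1 - 7/2 * 1/6]. Hence [ln N <= 12/5 * y + 18/5 * |ln kappa|]; the coefficients 3 and 4
   round this up, using [0 <= y]. *)
lra.
Qed.

(** The squared exponential is [l ^+ 3 * B ^+ 2 / v], so the hypothesis on [theta ^+ 2 * v] bounds
    [theta * B * l] by [log_arg] up to the factor [2 sqrt C]. *)
Lemma expR_tilt_bound (R : realType) (theta l v B C : R) :
  0 < l -> 0 < v -> 0 < B -> theta ^+ 2 * v <= 4 * C * l ->
  (theta * B * l) ^+ 2 <=
    4 * C * expR (3 / 2 * ln l - 1 / 2 * ln v + ln B) ^+ 2.
Proof.
move=> l0 v0 B0 h.
have -> : expR (3 / 2 * ln l - 1 / 2 * ln v + ln B) ^+ 2 = l ^+ 3 * B ^+ 2 / v.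
  rewrite -expRM_natl.
  have -> : 2%:R * (3 / 2 * ln l - 1 / 2 * ln v + ln B) =
     3%:R * ln l + 2%:R * ln B - ln v by lra.
  by rewrite expRB expRD !expRM_natl !lnK ?posrE.
rewrite mulrA ler_pdivlMr //.
have -> : (theta * B * l) ^+ 2 * v = theta ^+ 2 * v * (B ^+ 2 * l ^+ 2) by ring.
have -> : 4 * C * (l ^+ 3 * B ^+ 2) = 4 * C * l * (B ^+ 2 * l ^+ 2) by ring.
by rewrite ler_pM2r // mulr_gt0 ?exprn_gt0.
Qed.

(* The first conclusion forces [log_arg] to infinity with [omega]. *)
Lemma prob_L1_le_lower_bound (R : realType) (eps kappa c C omega : R) n (d : 'I_n -> nat)
    (theta : R) :
  0 < eps -> 0 < kappa -> 1 < c -> 1 <= C -> 0 < omega ->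
  degree_sequence d -> (0 < n)%N -> 0 < theta < 1 ->
  derive1 (phi d) theta = 0 -> 0 < derive1n 2 (phi d) theta ->
  kappa * theta ^+ 2 <= 1 - phi d theta ->
  1 + theta * (max_degree d)%:R <= C + 3 * ln (log_arg d theta) ->
  c <= log_arg d theta ->
  omega * Tn d theta <= theta * (total_degree d)%:R ->
  (omega * ln c) ^+ 2 <=
    4 * (C + 3 * ln (log_arg d theta)) * expR (ln (log_arg d theta)) ^+ 2 /\
  (2 <= ln (log_arg d theta) ->
   expR 1 * (1 + eps + (ln c)^-1) <= eps / (2 * (1 + eps)) * (kappa * omega) ->
   1 - 8 * expR 1 * C * expR (- (eps / 2 * ln (log_arg d theta))) <=
   prob_CM R d (fun G => (L1 G)%:R <= (1 + eps) * Tn d theta)).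
Proof.
move=> eps0 k0 c1 C1 w0 [d1 _ dev] n0 /andP[th0 th1] crit v0 hk hC hc hT.
have y_def := ln_log_arg n0 _ v0.
have lnc : 0 < ln c by rewrite ln_gt0.
have cy : ln c <= ln (log_arg d theta) by rewrite ler_ln ?posrE //; lra.
move: hC hT y_def; rewrite /Tn; set y := ln (log_arg d theta) in cy *.
set l := ln (1 / phi d theta); set F := phi d theta in hk l *.
move=> hC hT y_def; set T := 1 / l * y in hT *.
have m0 : 0 < (total_degree d)%:R :> R.
  by rewrite ltr0n (leq_trans n0) // total_degree_ge.
have th2 : 0 < theta ^+ 2 by rewrite exprn_gt0.
have kth : 0 < kappa * theta ^+ 2 by rewrite mulr_gt0.
have F1 : F < 1 by lra.
have Fe : expR (-1) <= F.
  apply: (@le_trans _ _ (expR (- theta))); first by rewrite ler_expR; lra.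
  by rewrite /F phiE; apply: tilted0_ge => //; exact: ltW.
have F0 : 0 < F := lt_le_trans (expR_gt0 _) Fe.
have lE : l = - ln F by rewrite /l ln_div ?posrE // ln1 add0r.
have l_ge : 1 - F <= l.
  rewrite lE; have : ln (1 + (F - 1)) <= F - 1 by apply: le_ln1Dx; lra.
  rewrite (_ : 1 + (F - 1) = F); lra.
have l1 : l <= 1.
  by rewrite lE lerNl -[X in X <= _]expRK ler_ln ?posrE ?expR_gt0.
have l0 : 0 < l by lra.
have kl : kappa * theta ^+ 2 <= l by lra.
set B := exp_moment d theta in y_def *.
have mB : (total_degree d)%:R <= B.
  exact: total_degree_le_exp_moment (ltW th0).
have B0 : 0 < B := lt_le_trans m0 mB.
have {}y_def := y_def l0 B0.
set z := theta * B * l.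
have hz : z ^+ 2 <= 4 * (C + 3 * y) * expR y ^+ 2.
  rewrite y_def; apply: expR_tilt_bound => //; rewrite -y_def derive2_phi.
  have crit' : tilted d 1 theta = 0 by rewrite -derive_phi.
  apply: (le_trans (critical_variance_le d1 n0 th0 crit')).
  rewrite -phiE -/F; have hd0 : 0 <= theta * (max_degree d)%:R.
    by rewrite mulr_ge0 // ltW.
  apply: (@le_trans _ _ (4 * (1 + theta * (max_degree d)%:R) * l)).
    by rewrite ler_wpM2l // mulr_ge0 //; lra.
  by rewrite ler_wpM2r ?(ltW l0) //; lra.
have z0 : 0 < z by rewrite !mulr_gt0.
have Tl : T * l = y by rewrite /T mul1r mulrAC mulVf ?gt_eqF // mul1r.
(* Since [l <= 1], [T] is at least [ln c]; rounding [(1 + eps) * T] to an integer then costs only a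
   constant factor. *)
have T_ge : ln c <= T by rewrite (le_trans cy) // -Tl ler_piMr // -(pmulr_lge0 _ l0) Tl; lra.
split.
  have wz : omega * ln c <= z.
    apply: (@le_trans _ _ (omega * T * l)).
      by rewrite -mulrA Tl ler_pM2l.
    by rewrite /z ler_pM2r // (le_trans hT) // ler_pM2l.
  by apply: le_trans hz; rewrite lerXn2r ?nnegrE ?(ltW z0) // mulr_ge0 ?ltW.
move=> y2 hw.
have hB := sum_expRB1_le d theta; rewrite -/B in hB.
have FE : F = phi d theta by [].
have zE : z = theta * B * l by [].
clearbody z T l y F B; clear y_def.
have T0 : 0 < T by apply: lt_le_trans T_ge.
have eps1 : 0 < 1 + eps by rewrite addr_gt0.
have [r rE] : exists r, r = (1 + eps) * T by exists ((1 + eps) * T).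
have r0 : 0 <= r by rewrite rE mulr_ge0 // ltW.
rewrite -rE.
(* The least integer above [r], so that [L1 <= r] is the negation of [s <= L1]. *)
pose s := (Num.truncn r).+1.
have sr : r < s%:R by rewrite /s -truncn_lt_nat // ltnS.
have sr' : s.-1%:R <= r by rewrite /= -truncn_ge_nat.
have s1 : s%:R = s.-1%:R + 1 :> R by rewrite natr1.
have s_le : s%:R <= (1 + eps + (ln c)^-1) * T.
  rewrite mulrDl -rE s1 lerD // mulrC -ler_pdivrMr ?invr_gt0 // invrK mul1r //.
(* Half of the slack [eps] is given up: replacing [F] by [psi] costs a factor [1 - delta] in the
   exponent, and [(1 - delta) * (1 + eps) = 1 + eps / 2]. *)
have [delta deltaE] : exists delta, delta = eps / (2 * (1 + eps)).
  by exists (eps / (2 * (1 + eps))).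
have delta_eps : delta * (1 + eps) = eps / 2.
  by rewrite deltaE; field; exact: lt0r_neq0.
rewrite -deltaE in hw.
have delta0 : 0 < delta by rewrite deltaE divr_gt0 // mulr_gt0.
have delta1 : delta < 1.
  by rewrite -(ltr_pM2r eps1) delta_eps; move: eps0; clear; lra.
pose psi := F + s%:R * theta / (total_degree d)%:R.
(* As [T <= theta * m / omega], the perturbation [s * theta / m] is of order [theta ^+ 2 / omega],
   and [kappa * theta ^+ 2 <= l]. The factor [expR 1] allows for a division by [F >= expR (-1)]. *)
have small : expR 1 * (s%:R * theta / (total_degree d)%:R) <= delta * l.
  rewrite mulrA ler_pdivrMr //.
  have e0 := expR_gt0 (1 : R).
  have h1 : omega * (s%:R * theta) <= (1 + eps + (ln c)^-1) * (theta ^+ 2 * (total_degree d)%:R).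
    apply: (@le_trans _ _ ((1 + eps + (ln c)^-1) * theta * (omega * T))).
      rewrite [X in _ <= X](_ : _ =
        (1 + eps + (ln c)^-1) * T * (theta * omega)); last by ring.
      rewrite [X in X <= _](_ : _ = s%:R * (theta * omega)); last by ring.
      by rewrite ler_wpM2r // mulr_ge0 // ltW.
    have a0 : 0 <= (1 + eps + (ln c)^-1) * theta.
      by rewrite mulr_ge0 ?(ltW th0) // addr_ge0 ?invr_ge0 ?(ltW lnc) ?(ltW eps1).
    by apply: (le_trans (ler_wpM2l a0 hT)); rewrite expr2 !mulrA.
  rewrite -(ler_pM2l w0).
  apply: (@le_trans _ _ (expR 1 * ((1 + eps + (ln c)^-1) * (theta ^+ 2 * (total_degree d)%:R)))).
    by rewrite mulrCA ler_pM2l.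
  apply: (@le_trans _ _ (delta * (kappa * omega) * (theta ^+ 2 * (total_degree d)%:R))).
    by rewrite mulrA ler_wpM2r // mulr_ge0 // ltW.
  rewrite (_ : _ * _ = delta * omega * (total_degree d)%:R * (kappa * theta ^+ 2)); last by ring.
  rewrite (_ : omega * _ = delta * omega * (total_degree d)%:R * l); last by ring.
  by rewrite ler_wpM2l // (mulr_ge0 (mulr_ge0 (ltW delta0) (ltW w0)) (ltW m0)).
have sth0 : 0 <= s%:R * theta / (total_degree d)%:R.
  by rewrite divr_ge0 ?mulr_ge0 // ltW.
have psi0 : 0 < psi by rewrite ltr_wpDr.
have psi_le : psi <= expR (- ((1 - delta) * l)).
  have -> : - ((1 - delta) * l) = ln F + delta * l by rewrite lE; ring.
  rewrite expRD lnK ?posrE //.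
  apply: (@le_trans _ _ (F * (1 + delta * l))); last first.
    by rewrite ler_pM2l // expR_ge1Dx.
  rewrite mulrDr mulr1 /psi lerD2l.
  apply: (@le_trans _ _ (expR (-1) * (delta * l))); last first.
    by rewrite ler_wpM2r // mulr_ge0 // ltW.
  by rewrite expRN [leRHS]mulrC ler_pdivlMr ?expR_gt0 // [leLHS]mulrC.
have dl0 : 0 <= (1 - delta) * l by rewrite mulr_ge0 ?subr_ge0 ?(ltW l0) ?(ltW delta1).
have psi1 : psi <= 1.
  by apply: (le_trans psi_le); rewrite -[X in _ <= X]expR0 ler_expR oppr_le0.
have hsum : \sum_i (d i)%:R * expR (theta * ((d i)%:R - 2)) + s%:R * theta <=
    (total_degree d)%:R * psi.
  rewrite /psi mulrDr [X in _ <= _ + X]mulrC divfK ?gt_eqF // lerD2r.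
  rewrite FE phiE /tilted mulVKf ?gt_eqF //.
  by apply: ler_sum => i _; rewrite expr0 mulr1.
have hpsi : 0 < psi <= 1 by rewrite psi0.
have := prob_large_L1 (ltW th0) hpsi hsum (ltn0Sn _).
rewrite -/s; set p := prob_CM _ _ _ => hp.
have p0 : 0 <= p by rewrite divr_ge0.
have -> : prob_CM R d (fun G => (L1 G)%:R <= r) = 1 - p.
  rewrite prob_CM_compl ?pairings_gt0 //; congr (1 - _).
  rewrite /p /prob_CM; congr (_%:R / _); apply: eq_card => f; rewrite !inE.
  by rewrite -ltNge /s -truncn_lt_nat.
rewrite lerD2l lerN2.
(* The [- 1] in the exponent pays for [r - 1] in place of [r], through [(1 - delta) * l <= 1]. *)
have Q0 : expR ((1 + eps / 2) * y - 1) <= psi^-1 ^+ s.-1.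
  apply: (@le_trans _ _ (expR ((1 - delta) * l) ^+ s.-1)); last first.
    rewrite lerXn2r ?nnegrE ?expR_ge0 ?invr_ge0 ?(ltW psi0) //.
    by rewrite -[X in X <= _]invrK -expRN lef_pV2 ?posrE ?expR_gt0.
  rewrite -expRM_natl ler_expR.
  apply: (@le_trans _ _ ((r - 1) * ((1 - delta) * l))); last first.
    by rewrite ler_wpM2r //; move: s1 sr; clear; lra.
  have -> : (r - 1) * ((1 - delta) * l) =
      (1 + eps - delta * (1 + eps)) * (T * l) - (1 - delta) * l.
    by rewrite rE; ring.
  rewrite Tl delta_eps.
  have : (1 - delta) * l <= 1 by move: delta0 delta1 l0 l1; clear; nra.
  by clear; lra.
(* A power of at least 2 loses at most half of its value when 1 is subtracted. *)
have Q2 : 2 <= expR ((1 + eps / 2) * y - 1).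
  by apply: le_trans (expR_ge1Dx _); move: y2 eps0; clear; nra.
have y0 : 0 < y := lt_le_trans (ltr0Sn _ 1) y2.
have C0 : 0 < C := lt_le_trans ltr01 C1.
have hz' : z <= 4 * C * y * expR y.
  rewrite -(@ler_pXn2r _ 2) ?nnegrE ?mulr_ge0 ?expR_ge0 ?(ltW z0) ?(ltW y0) ?(ltW C0) //.
  apply: (le_trans hz); rewrite [X in _ <= X]exprMn ler_wpM2r ?sqr_ge0 //.
  have ty : y <= C * y by rewrite ler_peMl // ltW.
  have tC : C <= C * y by rewrite ler_peMr ?(ltW C0) //; move: y2; clear; lra.
  rewrite -mulrA; move: y2 ty tC; clear; set t := C * y; nra.
(* Multiplying the first moment bound by [l] turns [T] into [y] and [theta * B] into [z]; the factor
   [y] of [hz'] then cancels. *)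
have hpz : p * (y * (expR ((1 + eps / 2) * y - 1) / 2)) <= 4 * C * y * expR y.
  apply: le_trans hz'.
  rewrite -Tl zE (_ : p * _ =
    p * (T * (expR ((1 + eps / 2) * (T * l) - 1) / 2)) * l); last by ring.
  rewrite Tl ler_pM2r //; apply: le_trans hB; apply: le_trans hp.
  apply: ler_wpM2l => //; apply: ler_pM; [exact: ltW|by rewrite divr_ge0 ?expR_ge0| |].
    by apply: le_trans (ltW sr); rewrite rE ler_peMl ?(ltW T0) // lerDl ltW.
  by move: Q0 Q2; clear; lra.
rewrite -(ler_pM2r (expR_gt0 ((1 + eps / 2) * y - 1))).
rewrite -[X in _ <= X]mulrA -expRD.
rewrite (_ : - (eps / 2 * y) + _ = y - 1); last by ring.
have -> : 8 * expR 1 * C * expR (y - 1) = 8 * C * expR y.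
  rewrite expRD expRN; field; exact: lt0r_neq0 (expR_gt0 _).
by rewrite -(ler_pM2l y0); move: hpz; clear; lra.
Qed.

(** * A positive proportion of degrees other than 2 *)

(** The probability of degree 2 is the difference of the distribution functions at 5/2 and 3/2,
    continuity points since [D] is integer-valued. Its limit is at most [1 - q], with [q] the mass
    of [D] outside 0 and 2. *)
Lemma fraction_not_two (R : realType) (d : forall n : nat, 'I_n -> nat)
    (disp : measure_display) (Omega : measurableType disp)
    (P : probability Omega R) (D : {RV P >-> nat}) :
  cvg_distribution d D -> (0 < P [set w | ~ (D w = 0%N \/ D w = 2%N)])%E ->
  exists2 p : R, 0 < p &
    \forall n \near \oo, p <= #|[pred i : 'I_n | d n i != 2%N]|%:R / n%:R.
Proof.
move=> hF hN.
have mD (A : set nat) : measurable (D @^-1` A).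
  by rewrite -[X in measurable X]setTI; apply: measurable_funP.
have setE (k : nat) (y : R) : k%:R < y < k.+1%:R ->
    [set w | (D w)%:R <= y] = D @^-1` [set j | (j <= k)%N].
  move=> /andP[ky yk]; apply/seteqP; split => w /= h.
    by rewrite -ltnS -(ltr_nat R); apply: le_lt_trans h yk.
  by apply: le_trans (ltW ky); rewrite ler_nat.
have cvgF (k : nat) : prob_D R (d n) [set j | (j <= k)%N] @[n --> \oo] -->
    fine (P (D @^-1` [set j | (j <= k)%N])).
  have hk : k%:R < (k%:R + 2^-1 : R) < k.+1%:R by rewrite -(natr1 k); apply/andP; split; lra.
  rewrite -(setE _ _ hk).
  have -> : [set j | (j <= k)%N] = [set j | j%:R <= (k%:R + 2^-1 : R)].
    apply/seteqP; split => j /= h.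
      by apply: (@le_trans _ _ k%:R); [rewrite ler_nat|lra].
    by rewrite -ltnS -(ltr_nat R); case/andP: hk => _; apply: le_lt_trans.
  apply: hF; apply: cvg_near_cst; near=> y; congr (fine (P _)).
  rewrite (setE _ _ hk); apply: setE.
  have : `|(k%:R + 2^-1) - y| < 4^-1.
    by near: y; apply/nbhs_ballP; exists 4^-1 => //=; rewrite invr_gt0.
  by rewrite ltr_distlC -(natr1 k) => /andP[h1 h2]; apply/andP; split; lra.
set q := fine (P [set w | ~ (D w = 0%N \/ D w = 2%N)]).
have mN : [set w | ~ (D w = 0%N \/ D w = 2%N)] =
  D @^-1` [set j | ~ (j = 0%N \/ j = 2%N)] by [].
have mNm : measurable [set w | ~ (D w = 0%N \/ D w = 2%N)] by rewrite mN.
have q0 : 0 < q by rewrite fine_gt0 // hN /= mN -ge0_fin_numE // fin_num_measure.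
exists (q / 2); first by rewrite divr_gt0.
have hq : fine (P (D @^-1` [set j | (j <= 2)%N])) -
    fine (P (D @^-1` [set j | (j <= 1)%N])) <= 1 - q.
  have -> : D @^-1` [set j | (j <= 2)%N] =
     D @^-1` [set j | (j <= 1)%N] `|` D @^-1` [set 2%N].
    apply/seteqP; split => w /=; first by rewrite leq_eqVlt => /orP[/eqP ->|]; [right|left].
    by case=> [h|-> //]; exact: leq_trans h _.
  rewrite measureU //; last first.
    by apply/seteqP; split => w //= -[] /[swap] ->.
  rewrite fineD ?fin_num_measure // addrAC subrr add0r lerBrDr.
  rewrite -fineD ?fin_num_measure //.
  rewrite -measureU //; last first.
    by apply/seteqP; split => w //= -[->] []; right.
  have mU : measurable (D @^-1` [set 2%N] `|`
      [set w | ~ (D w = 0%N \/ D w = 2%N)])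
    by exact: measurableU.
  by rewrite -lee_fin fineK ?fin_num_measure // probability_le1.
have h := cvgB (cvgF 2%N) (cvgF 1%N).
have hlt : fine (P (D @^-1` [set j | (j <= 2)%N])) -
    fine (P (D @^-1` [set j | (j <= 1)%N])) < 1 - q / 2.
  by move: q0 hq; clear; lra.
have hn : \forall n \near \oo, prob_D R (d n) [set j | (j <= 2)%N] -
    prob_D R (d n) [set j | (j <= 1)%N] < 1 - q / 2.
  exact: cvgr_lt _ (h _) _ hlt.
near=> n.
have n0 : (0 < n)%N by near: n; exact: nbhs_infty_gt.
have n0R : 0 < n%:R :> R by rewrite ltr0n.
have : prob_D R (d n) [set j | (j <= 2)%N] -
    prob_D R (d n) [set j | (j <= 1)%N] < 1 - q / 2 by near: n.
have -> : prob_D R (d n) [set j | (j <= 2)%N] -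
    prob_D R (d n) [set j | (j <= 1)%N] =
    1 - #|[pred i : 'I_n | d n i != 2%N]|%:R / n%:R.
  rewrite /prob_D -mulrBl.
  have -> : #|[pred i : 'I_n | d n i \in [set j | (j <= 2)%N]]| =
      (#|[pred i : 'I_n | d n i \in [set j | (j <= 1)%N]]| +
       #|[pred i : 'I_n | d n i == 2%N]|)%N.
    rewrite -cardUI [X in (_ + X)%N](_ : _ = 0%N) ?addn0; last first.
      apply: eq_card0 => i; rewrite !inE; apply/negbTE/negP => /andP[h1 /eqP h2].
      by move: h1; rewrite h2 inE.
    apply: eq_card => i; rewrite !inE; apply/idP/idP; rewrite inE /=.
      by rewrite leq_eqVlt => /orP[->|h1]; rewrite ?orbT //; apply/orP; left; rewrite inE.
    by case/orP => [|/eqP -> //]; rewrite inE /= => h1; exact: leq_trans h1 _.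
  rewrite natrD addrC addKr.
  have := cardC [pred i : 'I_n | d n i == 2%N]; rewrite card_ord.
  move/(congr1 (fun k : nat => k%:R : R)); rewrite natrD => e.
  apply: (mulIf (lt0r_neq0 n0R)); rewrite mulrBl mul1r !divfK ?gt_eqF //.
  by rewrite -[in RHS]e addrK.
lra.
Unshelve. all: by end_near. Qed.

(** * Choice of constants and passage to the limit *)

(** A sum of squares with nonnegative weights is nonnegative; were it 0, the convention [0^-1 = 0]
    would make [log_arg] vanish. *)
Lemma derive2_phi_gt0 (R : realType) n (d : 'I_n -> nat) (theta : R) :
  0 < log_arg d theta -> 0 < derive1n 2 (phi d) theta.
Proof.
move=> L0; rewrite lt0r; apply/andP; split.
  have h0 : (1 / 2 : R) != 0 by rewrite gt_eqF.
  by apply: contraTneq L0 => v0; rewrite /log_arg v0 (powR0 h0) invr0 mulr0 !mul0r ltxx.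
rewrite derive2_phi mulr_ge0 ?invr_ge0 //; apply: sumr_ge0 => i _.
by rewrite mulr_ge0 ?expR_ge0 // mulr_ge0 ?sqr_ge0.
Qed.

Theorem theorem1p5 (R : realType) (eps : R) (heps : 0 < eps)
  (d : forall n : nat, 'I_n -> nat)
  (hd : forall n, degree_sequence (d n))
  (hQ : \forall n \near \oo, Qn R (d n) <= 0)
  (hA : assumptionA R d)
  (hDelta : \forall n \near \oo,
     (max_degree (d n))%:R <= n%:R `^ (6^-1 : R))
  (theta0 : nat -> R)
  (htheta0 : \forall n \near \oo, smallest_critical_point (d n) (theta0 n))
  (c : R) (hc : 1 < c)
  (hlog : \forall n \near \oo, c <= log_arg (d n) (theta0 n))
  (omega : nat -> R) (homega : omega n @[n --> \oo] --> +oo)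
  (hT : \forall n \near \oo,
     omega n * Tn (d n) (theta0 n) <= theta0 n * (total_degree (d n))%:R) :
  prob_CM R (d n) (fun G => (L1 G)%:R <= (1 + eps) * Tn (d n) (theta0 n))
    @[n --> \oo] --> (1 : R).
Proof.
have [disp [T [P [D [hF _ hN _ _]]]]] := hA.
have [p p0 hp] := fraction_not_two hF hN.
have e0 : 0 < expR (-1) :> R := expR_gt0 _.
(* The product of [expR (-1) / 4] from [critical_defect_ge] and of [p / 2], where the 2 comes from
   [m <= 2 * n]. *)
pose kappa := expR (-1) / 8 * p.
have k0 : 0 < kappa by rewrite mulr_gt0 ?divr_gt0.
pose C := 9 + 4 * `|ln kappa|.
have C1 : 1 <= C by rewrite /C; have := normr_ge0 (ln kappa); lra.
have C0 : 0 < C := lt_le_trans ltr01 C1.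
have lnc : 0 < ln c by rewrite ln_gt0.
apply/cvgrPdist_le => delta delta0.
pose M := 8 * expR 1 * C.
have M0 : 0 < M by rewrite !mulr_gt0 ?expR_gt0.
(* For [y >= Y] the error [M * expR (- (eps / 2 * y))] is at most [delta], by [x <= expR x]; the
   summand 2 meets the threshold of [prob_L1_le_lower_bound]. *)
pose Y := 2 + 2 / eps * (M / delta).
have Y2 : 2 <= Y by rewrite lerDl !mulr_ge0 ?invr_ge0 // ltW.
(* The bound on [(omega n * ln c) ^+ 2] that [ln (log_arg _ _) < Y] would imply. *)
pose K := 4 * (C + 3 * Y) * expR Y ^+ 2.
have K0 : 0 <= K.
  by rewrite mulr_ge0 ?sqr_ge0 // mulr_ge0 // addr_ge0 ?(ltW C0) // mulr_ge0 //
    (le_trans _ Y2).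
(* The first summand forces [omega n * ln c >= K + 1], whose square exceeds [K]; the second yields
   the smallness condition on the perturbation of [phi]. *)
pose W := (K + 1) / ln c +
  expR 1 * (1 + eps + (ln c)^-1) / (eps / (2 * (1 + eps)) * kappa).
have eps1 : 0 < 1 + eps by rewrite addr_gt0.
have dk0 : 0 < eps / (2 * (1 + eps)) * kappa.
  by rewrite mulr_gt0 ?divr_gt0 ?mulr_gt0.
have W1 : 0 < (K + 1) / ln c by rewrite divr_gt0 // ltr_wpDl.
have W2 : 0 <= expR 1 * (1 + eps + (ln c)^-1) / (eps / (2 * (1 + eps)) * kappa).
  by rewrite divr_ge0 ?(ltW dk0) // mulr_ge0 ?expR_ge0 // addr_ge0 ?invr_ge0 ?ltW.
have hW : \forall n \near \oo, W <= omega n by move/cvgryPge: homega; apply.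
near=> n.
have n0 : (0 < n)%N by near: n; exact: nbhs_infty_gt.
have Qn0 : Qn R (d n) <= 0 by near: n.
have pn : p <= #|[pred i : 'I_n | d n i != 2%N]|%:R / n%:R by near: n.
have Dn : (max_degree (d n))%:R <= n%:R `^ (6^-1 : R) by near: n.
have [th01 crit _] : smallest_critical_point (d n) (theta0 n) by near: n.
have cL : c <= log_arg (d n) (theta0 n) by near: n.
have hTn : omega n * Tn (d n) (theta0 n) <= theta0 n * (total_degree (d n))%:R.
  by near: n.
have Wn : W <= omega n by near: n.
have dn := hd n; have [d1 _ dev] := dn.
have [th0 th1] := andP th01.
have v0 := derive2_phi_gt0 (lt_trans ltr01 (lt_le_trans hc cL)).
have n0R : 0 < n%:R :> R by rewrite ltr0n.
have m0 : 0 < (total_degree (d n))%:R :> R.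
  by rewrite ltr0n (leq_trans n0) // total_degree_ge.
have crit1 : tilted (d n) 1 (theta0 n) = 0 by rewrite -derive_phi.
have m2n := total_degree_le d1 Qn0.
have kth : kappa * theta0 n ^+ 2 <= 1 - phi (d n) (theta0 n).
  rewrite phiE; apply: le_trans (critical_defect_ge d1 n0 th0 th1 crit1).
  rewrite [leLHS](_ : _ = expR (-1) / 4 * theta0 n ^+ 2 * (p / 2)); last first.
    by rewrite /kappa; lra.
  apply: ler_wpM2l; first by rewrite mulr_ge0 ?sqr_ge0 // divr_ge0 // ltW.
  rewrite ler_pdivlMr // mulrAC ler_pdivrMr //.
  apply: (@le_trans _ _ (p * (2 * n%:R))); first by rewrite ler_pM2l.
  by rewrite mulrCA mulrC ler_pM2r // -ler_pdivlMr.
have kth0 : 0 < kappa * theta0 n ^+ 2 by rewrite mulr_gt0 ?exprn_gt0.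
have F0 : 0 < phi (d n) (theta0 n).
  by rewrite phiE (lt_le_trans (expR_gt0 _) (tilted0_ge d1 n0 (ltW th0))).
have l_ge : 1 - phi (d n) (theta0 n) <= ln (1 / phi (d n) (theta0 n)).
  rewrite ln_div ?posrE // ln1 add0r lerNr opprB.
  have : ln (1 + (phi (d n) (theta0 n) - 1)) <= phi (d n) (theta0 n) - 1.
    by apply: le_ln1Dx; move: F0; clear; lra.
  by rewrite addrC subrK.
have l0 : 0 < ln (1 / phi (d n) (theta0 n)).
  exact: lt_le_trans kth0 (le_trans kth l_ge).
have mB := total_degree_le_exp_moment (d n) (ltW th0).
have B0 := lt_le_trans m0 mB.
have yE := ln_log_arg n0 l0 v0 B0.
have y0 : 0 < ln (log_arg (d n) (theta0 n)).
  by rewrite ln_gt0 // (lt_le_trans hc).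
have star : 1 + theta0 n * (max_degree (d n))%:R <=
    C + 3 * ln (log_arg (d n) (theta0 n)).
  rewrite yE; apply: (exponent_le_ln (m := (total_degree (d n))%:R) k0 th01 _ _ _ m2n Dn).
  - exact: le_trans kth l_ge.
  - rewrite v0 derive2_phi; exact: critical_variance_le_max.
  - rewrite ler1n n0 /=; apply: le_trans mB.
    by rewrite ler_nat total_degree_ge.
  - exact: critical_expR_max_le.
  - by rewrite -yE ltW.
have w0 : 0 < omega n by apply: lt_le_trans Wn; rewrite ltr_wpDr.
have [hy hprob] := prob_L1_le_lower_bound heps k0 hc C1 w0 dn n0 th01 crit v0 kth star cL hTn.
have Yy : Y <= ln (log_arg (d n) (theta0 n)).
  rewrite leNgt; apply/negP => yY.
  have : (omega n * ln c) ^+ 2 <= K.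
    apply: (le_trans hy); apply: ler_pM.
    - by rewrite mulr_ge0 // addr_ge0 ?(ltW C0) // mulr_ge0 // ltW.
    - exact: sqr_ge0.
    - by rewrite ler_pM2l // lerD2l ler_pM2l // ltW.
    - by rewrite lerXn2r ?nnegrE ?expR_ge0 // ler_expR ltW.
  apply/negP; rewrite -ltNge.
  have Kw : K + 1 <= omega n * ln c.
    by rewrite -ler_pdivrMr //; apply: le_trans Wn; rewrite lerDl.
  by move: K0 Kw; clear; set a := _ * _; nra.
have := hprob (le_trans Y2 Yy); rewrite -/M.
set pr := prob_CM _ _ _ => {}hprob.
have pr1 : pr <= 1.
  by rewrite /pr prob_CM_compl ?pairings_gt0 // gerBl divr_ge0.
rewrite ger0_norm ?subr_ge0 // lerBlDr -lerBlDl.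
apply: le_trans (hprob _); last first.
  rewrite mulrA -ler_pdivrMl // mulrC; apply: le_trans Wn.
  by rewrite lerDr ltW.
rewrite lerD2l lerN2 expRN ler_pdivrMr ?expR_gt0 // mulrC -ler_pdivrMr //.
apply: le_trans (expR_ge1Dx _).
apply: (@le_trans _ _ (eps / 2 * Y)); last first.
  by rewrite ler_wpDl // ler_wpM2l // divr_ge0 // ltW.
rewrite /Y mulrDr mulrA [X in _ + X * _](_ : _ = 1); last first.
  by field; exact: lt0r_neq0.
by rewrite mul1r lerDr mulr_ge0 // divr_ge0 // ltW.
Unshelve. all: by end_near. Qed.
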